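(* Let $n$ be a positive integer and let $\mu,\nu:\{1,\dots,n\}\to[0,\infty)$ be non-negative functions with $\|\mu\|_1\le 1$ and $\|\nu\|_1\le 1$. Let $\eta,\delta>0$. Let $X=\{f\in\mathbb{R}^n: |f(x)|\le\max\{\mu(x),\nu(x)\}\text{ for every }x\}$ and let $\|\cdot\|$ be a QAP-norm on $\mathbb{R}^n$ with respect to $X$, with associated operator $\mathcal{D}$, function $c$ and function $C$ (see context). Let $J:\mathbb{R}\to\mathbb{R}$ be $J(x)=(x+|x|)/2$, and let $$\epsilon=\frac{\delta}{2\rho'\bigl(C(1)c(\eta)^{-1},\,c(\eta)^{-1},\,\delta/4,\,J\bigr)}.$$ Suppose that $\|\mu-\nu\|\le\epsilon$. Then for every function $f$ with $0\le f\le\mu$ (pointwise) there exists a function $g$ such that $0\le g\le(1-\delta)^{-1}\nu$ (pointwise) and $\|f-g\|\le\eta$.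
   Context: Functions in $\mathbb{R}^n$ are viewed as functions on $\{1,\dots,n\}$ with inner product $\langle f,g\rangle=\frac1n\sum_x f(x)g(x)$ and $\|f\|_p=(\frac1n\sum_x|f(x)|^p)^{1/p}$, $\|f\|_\infty=\max_x|f(x)|$. For a norm $\|\cdot\|$ its dual norm is $\|\phi\|^*=\max\{\langle f,\phi\rangle:\|f\|\le1\}$. Products of functions are pointwise. QAP-norm: let $\|\cdot\|$ be a norm on $\mathbb{R}^n$ with $\|f\|_\infty\le\|f\|^*$ for all $f$, and let $X$ be a bounded subset of $\mathbb{R}^n$. Then $\|\cdot\|$ is a QAP-norm with respect to $X$ if there exist a (non-linear) map $\mathcal{D}:\mathbb{R}^n\to\mathbb{R}^n$, a strictly increasing function $c:\mathbb{R}_+\to\mathbb{R}_+$ and an increasing function $C:\mathbb{N}\to\mathbb{R}$ such that (i) $\langle f,\mathcal{D}f\rangle\le1$ for every $f\in X$; (ii) $\langle f,\mathcal{D}f\rangle\ge c(\epsilon)$ for every $f\in X$ with $\|f\|\ge\epsilon$; (iii) $\|\mathcal{D}f_1\cdots\mathcal{D}f_K\|^*\le C(K)$ for all $K$ and all $f_1,\dots,f_K\in X$. It is assumed that the functions $\mathcal{D}f$, $f\in X$, span $\mathbb{R}^n$. For a real polynomial $P(x)=a_mx^m+\dots+a_1x+a_0$ let $R'_P(x)=C(m)|a_m|x^m+\dots+C(1)|a_1|x+|a_0|$. For continuous $J:\mathbb{R}\to\mathbb{R}$ and $C_1,C_2,\delta>0$, $\rho'(C_1,C_2,\delta,J)$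 is twice the infimum of $R'_P(C_2)$ over all real polynomials $P$ with $|P(x)-J(x)|\le\delta$ for all $x\in[-C_1,C_1]$.
   Formalization: The formal theorem additionally assumes δ < 1; for δ = 1 the factor (1−δ)^{-1} is undefined, and for δ > 1 it is negative, so no g with 0 ≤ g ≤ (1−δ)^{-1}ν exists unless ν = 0. *)

(* Defs.v *)
From HB Require Import structures.
From mathcomp Require Import all_boot all_order all_algebra.
From mathcomp Require Import boolp classical_sets reals.
Set Implicit Arguments. Unset Strict Implicit. Unset Printing Implicit Defensive.
Import Order.TTheory GRing.Theory Num.Theory.
Local Open Scope classical_set_scope.
Local Open Scope ring_scope.

Section Defs.
Variable R : realType.

Definition dotv n (f g : 'I_n -> R) : R := n%:R^-1 * \sum_(x < n) f x * g x.

Definition norm1 n (f : 'I_n -> R) : R := n%:R^-1 * \sum_(x < n) `|f x|.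

Definition norminf n (f : 'I_n -> R) : R := \big[Num.max/0]_(x < n) `|f x|.

Definition is_norm n (N : ('I_n -> R) -> R) : Prop :=
  (forall f, 0 <= N f) /\
  (forall f, N f = 0 -> f = (fun _ => 0)) /\
  (forall (a : R) f, N (fun x => a * f x) = `|a| * N f) /\
  (forall f g, N (fun x => f x + g x) <= N f + N g).

Definition dual_norm n (N : ('I_n -> R) -> R) (phi : 'I_n -> R) : R :=
  sup [set dotv f phi | f in [set f | N f <= 1]].

Definition prodD n (D : ('I_n -> R) -> ('I_n -> R)) K (fs : 'I_K -> 'I_n -> R)
  : 'I_n -> R := fun x => \prod_(i < K) D (fs i) x.

Definition QAP_norm n (N : ('I_n -> R) -> R) (X : set ('I_n -> R))
  (D : ('I_n -> R) -> ('I_n -> R)) (c : R -> R) (C : nat -> R) : Prop :=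
  is_norm N /\
  (forall f, norminf f <= dual_norm N f) /\
  (forall x, 0 < x -> 0 < c x) /\
  (forall x y, 0 < x -> x < y -> c x < c y) /\
  (forall i j : nat, (i <= j)%N -> C i <= C j) /\
  (forall f, X f -> dotv f (D f) <= 1) /\
  (forall (eps : R) f, 0 < eps -> X f -> eps <= N f -> c eps <= dotv f (D f)) /\
  (forall K (fs : 'I_K -> 'I_n -> R), (0 < K)%N -> (forall i, X (fs i)) ->
      dual_norm N (prodD D fs) <= C K) /\
  (forall v : 'I_n -> R, exists K (fs : 'I_K -> 'I_n -> R) (a : 'I_K -> R),
      (forall i, X (fs i)) /\ v = (fun x => \sum_(i < K) a i * D (fs i) x)).

Definition Xset n (mu nu : 'I_n -> R) : set ('I_n -> R) :=
  [set f | forall x, `|f x| <= Num.max (mu x) (nu x)].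

Definition Rprime (C : nat -> R) (P : {poly R}) (x : R) : R :=
  \sum_(i < size P) (if val i == 0%N then 1 else C i) * `|P`_i| * x ^+ i.

Definition rho' (C : nat -> R) (C1 C2 delta : R) (J : R -> R) : R :=
  2 * inf [set Rprime C P C2 | P in
             [set P : {poly R} | forall x, - C1 <= x <= C1 -> `|P.[x] - J x| <= delta]].

End Defs.

(* Main.v *)
Require Import Defs.
From HB Require Import structures.
From mathcomp Require Import all_boot all_order all_algebra.
From mathcomp Require Import boolp classical_sets reals.
From mathcomp Require Import ring lra.
Import Order.TTheory GRing.Theory Num.Theory.
Local Open Scope ring_scope.

(** Even [0 <= g <= nu] can be achieved. If it cannot, every such [g] has
    [N (f - g) > eta], hence [f - g], which lies in [X], correlates with
    [D (f - g)] by more than [c eta]. Running projected gradient ascent on [g]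
    with these functions as directions (an elementary substitute for the
    Hahn-Banach theorem) produces an average [chi] of functions [D h], [h] in
    [X], such that [<f - g, chi>] is at least [c eta], up to a small error, for
    all [g] at once. For [phi = chi / c eta] and the best [g] this says
    [<mu, J phi> >= <nu, J phi> + 1 - o(1)]. But approximating [J] by a
    polynomial, and bounding the dual norms of the powers of [phi] by those of
    the products of functions [D h], shows that [<mu, J phi>] is at most
    [<nu, J phi> + delta]. *)

(** * Bilinearity and monotonicity of the normalized inner product *)

Section Dot.
Context {R : realType} {n : nat}.
Implicit Types f g h : 'I_n -> R.

Lemma dotvDl f g h : dotv (fun x => f x + g x) h = dotv f h + dotv g h.
Proof.
rewrite /dotv -mulrDr -big_split /=; congr (_ * _).
by apply: eq_bigr => x _; rewrite mulrDl.
Qed.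

Lemma dotvZl (a : R) f h : dotv (fun x => a * f x) h = a * dotv f h.
Proof.
rewrite /dotv mulrCA; congr (_ * _).
by rewrite mulr_sumr; apply: eq_bigr => x _; rewrite mulrA.
Qed.

Lemma dotvC f g : dotv f g = dotv g f.
Proof. by congr (_ * _); apply: eq_bigr => x _; rewrite mulrC. Qed.

Lemma dotvBl f g h : dotv (fun x => f x - g x) h = dotv f h - dotv g h.
Proof.
rewrite -[dotv g h]mul1r -mulNr -dotvZl -dotvDl.
by congr dotv; apply/funext => x; rewrite mulN1r.
Qed.

Lemma dotv_sumr (I : finType) f (F : I -> 'I_n -> R) :
  dotv f (fun x => \sum_i F i x) = \sum_i dotv f (F i).
Proof.
rewrite /dotv -mulr_sumr exchange_big /=; congr (_ * _).
by apply: eq_bigr => x _; rewrite mulr_sumr.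
Qed.

Lemma dotvZr (a : R) f h : dotv f (fun x => a * h x) = a * dotv f h.
Proof. by rewrite dotvC dotvZl dotvC. Qed.

Lemma ler_dotv f g f' g' :
  (forall x, f x * g x <= f' x * g' x) -> dotv f g <= dotv f' g'.
Proof. by move=> le; rewrite ler_wpM2l ?invr_ge0 ?ler0n// ler_sum. Qed.

Lemma ler_norminf f x : `|f x| <= norminf f.
Proof. by rewrite /norminf (bigD1 x) //= le_max lexx. Qed.

End Dot.

(** * Pairings bounded through the dual norm *)

Section DualNorm.
Context {R : realType} {n : nat} {N : ('I_n -> R) -> R}.
Context (normN : is_norm N).
Context (norminf_dual : forall f, norminf f <= dual_norm N f).

(* Were the supremum infinite, [sup] would be the junk value [0], and the
   comparison with [norminf] would force [phi = 0]. *)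
Lemma dual_has_sup phi :
  has_sup [set dotv f phi | f in [set f | N f <= 1]]%classic.
Proof.
case: normN => _ [_ [NZ _]].
apply: contrapT => nosup.
have phi0 x : phi x = 0.
  apply/eqP; rewrite -normr_le0 (le_trans (ler_norminf phi x))//.
  by rewrite (le_trans (norminf_dual phi))// /dual_norm sup_out.
apply: nosup; split.
  exists (dotv (fun=> 0 * 0) phi); exists (fun=> 0 * 0) => //=.
  by rewrite NZ normr0 mul0r.
exists 0 => _ [f _ <-]; rewrite /dotv big1 ?mulr0// => x _.
by rewrite phi0 mulr0.
Qed.

Lemma dotv_le_dual h phi : dotv h phi <= N h * dual_norm N phi.
Proof.
have [N0 [Neq0 [NZ _]]] := normN.
have [/Neq0 ->|Nh] := eqVneq (N h) 0.
  rewrite {1}/dotv big1 ?mulr0 => [|x _]; last by rewrite mul0r.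
  apply: mulr_ge0 => //; apply: le_trans (norminf_dual phi).
  by apply: bigmax_ge_id.
have Npos : 0 < N h by rewrite lt_def Nh N0.
rewrite -ler_pdivrMl// -dotvZl.
apply: ub_le_sup; first by case: (dual_has_sup phi).
exists (fun x => (N h)^-1 * h x) => //=.
by rewrite NZ ger0_norm ?invr_ge0 ?N0// mulVf.
Qed.

Lemma normr_dotv_le_dual h phi : `|dotv h phi| <= N h * dual_norm N phi.
Proof.
rewrite ler_norml dotv_le_dual andbT lerNl -mulN1r -dotvZl.
apply: le_trans (dotv_le_dual _ _) _.
by case: normN => _ [_ [-> _]]; rewrite normrN1 mul1r.
Qed.

(** The power expands into [T ^ k] products of the [d j], each paired with [h] by duality. Taking
    [a] proportional to [1 / T] makes the bound independent of [T]. *)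
Lemma dotv_pow_le {T : nat} (d : 'I_T -> 'I_n -> R) (h : 'I_n -> R)
    (k : nat) (a Ck : R) : 0 <= a ->
  (forall t : 'I_k -> 'I_T, dual_norm N (fun x => \prod_i d (t i) x) <= Ck) ->
  `|dotv h (fun x => (a * \sum_j d j x) ^+ k)| <= (a * T%:R) ^+ k * (N h * Ck).
Proof.
move=> a0 dualC.
have -> : (fun x => (a * \sum_j d j x) ^+ k) =
    (fun x => a ^+ k * \sum_(t : {ffun 'I_k -> 'I_T}) \prod_i d (t i) x).
  apply/funext => x; rewrite exprMn; congr (_ * _).
  rewrite -(bigA_distr_bigA (fun (_ : 'I_k) j => d j x)).
  by rewrite prodr_const card_ord.
rewrite dotvZr normrM ger0_norm ?exprn_ge0// exprMn -mulrA.
rewrite ler_wpM2l ?exprn_ge0// dotv_sumr.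
apply: le_trans (ler_norm_sum _ _ _) _.
have -> : T%:R ^+ k * (N h * Ck) = \sum_(t : {ffun 'I_k -> 'I_T}) (N h * Ck).
  by rewrite sumr_const card_ffun !card_ord -natrX mulr_natl.
apply: ler_sum => t _; apply: le_trans (normr_dotv_le_dual _ _) _.
by rewrite ler_wpM2l ?dualC//; case: normN.
Qed.

(* The constant coefficient is kept apart because the dual norm of the constant
   function [1] is not controlled. *)
Lemma dotv_horner_le {T : nat} (d : 'I_T -> 'I_n -> R) (h : 'I_n -> R)
    (a : R) (C : nat -> R) (P : {poly R}) : 0 <= a ->
  (forall k (t : 'I_k -> 'I_T), (0 < k)%N ->
    dual_norm N (fun x => \prod_i d (t i) x) <= C k) ->
  `|dotv h (fun x => P.[a * \sum_j d j x]) - P`_0 * dotv h (fun=> 1)|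
  <= N h * Rprime C P (a * T%:R).
Proof.
move=> a0 dualC; have N0 : 0 <= N h by case: normN.
under [fun x => _]eq_fun => x do rewrite horner_coef.
rewrite dotv_sumr /Rprime.
case: (size P) (@nth_default _ 0 P 0) => [|m] P0.
  by rewrite P0// !big_ord0 mul0r mulr0 subr0 normr0.
rewrite !big_ord_recl/= dotvZr addrC addKr.
apply: le_trans (ler_norm_sum _ _ _) _.
rewrite mulrDr mulr_sumr -[leLHS]add0r lerD//.
  by rewrite !mulr_ge0.
apply: ler_sum => i _; rewrite dotvZr normrM.
have pow := dotv_pow_le d h i.+1 a (C i.+1) a0 (fun t => dualC _ t isT).
apply: le_trans (ler_wpM2l (normr_ge0 _) pow) _.
by rewrite le_eqVlt; apply/orP; left; apply/eqP; rewrite /bump/= add1n; ring.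
Qed.

End DualNorm.

(** * Projection onto a box and gradient ascent inside it *)

Definition clip {R : realType} (b y : R) : R := Num.max 0 (Num.min b y).

Lemma clip_bounds {R : realType} (b y : R) : 0 <= b -> 0 <= clip b y <= b.
Proof. by move=> b0; rewrite /clip le_max lexx ge_max b0 ge_min lexx. Qed.

(** Projection onto an interval brings [y] no farther from any point of that interval. *)
Lemma clip_sqr {R : realType} (b y z : R) :
  0 <= z <= b -> (clip b y - z) ^+ 2 <= (y - z) ^+ 2.
Proof.
move=> /andP[z0 zb]; rewrite /clip; have b0 := le_trans z0 zb.
have [y0|y0] := leP y 0.
  rewrite (min_idPr (le_trans y0 b0)) (max_idPl y0).
  by rewrite -subr_ge0; have := mulr_ge0 z0 (_ : 0 <= - y); nra.
have [yb|/ltW yb] := leP y b; first by rewrite (max_idPr (ltW y0)).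
by rewrite (max_idPr b0) !expr2; apply: ler_pM; rewrite ?lerD2r// subr_ge0.
Qed.

Section OracleAverage.
Context {R : realType} {n : nat}.
Context (f nu : 'I_n -> R) (d : ('I_n -> R) -> 'I_n -> R) (B c0 : R).
Context (nu0 : forall x, 0 <= nu x).
Let box (g : 'I_n -> R) := forall x, 0 <= g x <= nu x.
Context (dB : forall g, box g -> forall x, `|d g x| <= B).
Context (dc : forall g, box g -> c0 <= dotv (fun x => f x - g x) (d g)).

Let ascent (s : R) g x := clip (nu x) (g x + s * d g x).
Let step s k := iter k (ascent s) (fun=> 0).

Let box_step s k : box (step s k).
Proof. by case: k => [|k] x; rewrite ?lexx ?nu0// clip_bounds. Qed.

(** Clipping only helps, so the square of the unclipped step is expanded; its second-order term is
    at most [s ^+ 2 * B ^+ 2] pointwise. *)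
Let regret s (g : 'I_n -> R) k : box g ->
  dotv (fun x => step s k.+1 x - g x) (fun x => step s k.+1 x - g x)
  <= dotv (fun x => step s k x - g x) (fun x => step s k x - g x)
     - 2 * s * dotv (fun x => g x - step s k x) (d (step s k))
     + s ^+ 2 * dotv (fun _ : 'I_n => B) (fun=> B).
Proof.
move=> gbox.
rewrite /dotv !(mulrCA _ n%:R^-1) -mulrBr -mulrDr.
rewrite ler_wpM2l ?invr_ge0 ?ler0n// !mulr_sumr -sumrB -big_split/=.
apply: ler_sum => x _; rewrite -expr2.
apply: le_trans (clip_sqr _ _ _ (gbox x)) _.
have Bd : (d (step s k) x) ^+ 2 <= B ^+ 2.
  by have := dB _ (box_step s k) x; rewrite ler_norml; nra.
rewrite -/(step s k).
move: (step s k x) (d _ x) (g x) Bd => a e b; nra.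
Qed.

(* Projected gradient ascent: the squared distance from the iterates to [g]
   controls the regret of the iterates against [g]. *)
Lemma oracle_average (kappa : R) : 0 < kappa ->
  exists (T : nat) (gs : 'I_T -> 'I_n -> R), [/\ (0 < T)%N,
    forall k, box (gs k) &
    forall g, box g -> c0 - kappa <=
      dotv (fun x => f x - g x) (fun x => T%:R^-1 * \sum_(k < T) d (gs k) x)].
Proof.
move=> kappa0.
pose E := dotv (fun _ : 'I_n => B) (fun=> B); pose V := dotv nu nu.
have E0 : 0 <= E.
  by rewrite mulr_ge0 ?invr_ge0 ?ler0n// sumr_ge0// => x _; rewrite -expr2 sqr_ge0.
(* A small [s] controls the second-order terms, then a large [T] the initial distance, at most [V];
   each costs [kappa / 2] on average. The [+ 1] covers [E = 0]. *)
have [s s0 sE] : exists2 s, 0 < s & s * E <= kappa.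
  exists (kappa / (E + 1)); first by rewrite divr_gt0//; lra.
  by rewrite mulrAC ler_pdivrMr; nra.
have [T T0 VT] : exists2 T, (0 < T)%N & V <= T%:R * (s * kappa).
  exists (Num.truncn (V / (s * kappa))).+1 => //.
  by rewrite -ler_pdivrMr ?mulr_gt0//; apply/ltW/truncnS_gt.
have T0R : 0 < T%:R :> R by rewrite ltr0n.
exists T, (fun k : 'I_T => step s k); split => // g gbox.
have tele t : 2 * s * (\sum_(k < t) dotv (fun x => g x - step s k x) (d (step s k)))
  <= V - dotv (fun x => step s t x - g x) (fun x => step s t x - g x) + t%:R * (s ^+ 2 * E).
  elim: t => [|t IH].
    rewrite big_ord0 mulr0 mul0r addr0 subr_ge0; apply: ler_dotv => x /=.
    by rewrite sub0r mulrNN; have /andP[? ?] := gbox x; apply: ler_pM.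
  rewrite big_ord_recr/= mulrDr -natr1 mulrDl mul1r.
  by move: (regret s g t gbox) IH; rewrite -/E; lra.
rewrite dotvZr ler_pdivlMl// dotv_sumr.
have low : T%:R * c0 <= \sum_(k < T) dotv (fun x => f x - step s k x) (d (step s k)).
  rewrite mulr_natl -[X in _ *+ X]card_ord -sumr_const.
  by apply: ler_sum => k _; apply: dc.
(* Split [f - g] at the [k]-th iterate: the oracle bounds the first part below, the regret bounds
   the second above. *)
have -> : \sum_(k < T) dotv (fun x => f x - g x) (d (step s k)) =
    \sum_(k < T) dotv (fun x => f x - step s k x) (d (step s k))
    - \sum_(k < T) dotv (fun x => g x - step s k x) (d (step s k)).
  rewrite -sumrB; apply: eq_bigr => k _; rewrite -dotvBl.
  by congr dotv; apply/funext => x; rewrite opprB addrA subrK.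
have D0 : 0 <= dotv (fun x => step s T x - g x) (fun x => step s T x - g x).
  by rewrite mulr_ge0 ?invr_ge0 ?ler0n// sumr_ge0// => x _; rewrite -expr2 sqr_ge0.
have up : 2 * s * (\sum_(k < T) dotv (fun x => g x - step s k x) (d (step s k)))
    <= 2 * s * (T%:R * kappa).
  apply: le_trans (tele T) _.
  have : T%:R * (s * (s * E)) <= T%:R * (s * kappa).
    by rewrite !ler_pM2l.
  rewrite expr2; lra.
rewrite ler_pM2l ?mulr_gt0// in up.
by rewrite mulrBr; lra.
Qed.
End OracleAverage.

(** * Comparison of [mu] and [nu] against a function of the average *)

Lemma dotv1_norm1 {R : realType} {n : nat} (f : 'I_n -> R) :
  (forall x, 0 <= f x) -> dotv f (fun=> 1) = norm1 f.
Proof.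
by move=> f0; congr (_ * _); apply: eq_bigr => x _; rewrite mulr1 ger0_norm.
Qed.

(** [J] is replaced by [P] under [mu], [mu] by [nu] through duality, and [P] by [J] again under
    [nu]. *)
Lemma transfer_pos_part {R : realType} {n T : nat} (N : ('I_n -> R) -> R)
    (mu nu : 'I_n -> R) (d : 'I_T -> 'I_n -> R) (a e B : R) (C : nat -> R)
    (P : {poly R}) (J : R -> R) :
  is_norm N -> (forall f, norminf f <= dual_norm N f) ->
  (forall x, 0 <= mu x) -> (forall x, 0 <= nu x) ->
  norm1 mu <= 1 -> norm1 nu <= 1 -> 0 <= a ->
  (forall k (t : 'I_k -> 'I_T), (0 < k)%N ->
    dual_norm N (fun x => \prod_i d (t i) x) <= C k) ->
  0 <= B -> (forall x, `|a * \sum_j d j x| <= B) ->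
  J 0 = 0 -> (forall x, - B <= x <= B -> `|P.[x] - J x| <= e) ->
  dotv mu (fun x => J (a * \sum_j d j x))
  <= dotv nu (fun x => J (a * \sum_j d j x)) + 2 * e
     + N (fun x => mu x - nu x) * Rprime C P (a * T%:R).
Proof.
move=> normN normi mu0 nu0 mu1 nu1 a0 dualC B0 phiB J0 PJ.
have := dotv_horner_le normN normi _ (fun x => mu x - nu x) a C P a0 dualC.
set phi := fun x => a * \sum_j d j x.
rewrite !dotvBl !dotv1_norm1// => /ler_normlP[_].
have P0 : `|P`_0| <= e.
  by have := PJ 0; rewrite horner_coef0 J0 subr0; apply; rewrite oppr_le0 B0.
have near x : `|P.[phi x] - J (phi x)| <= e.
  by apply: PJ; rewrite -ler_norml phiB.
have Pmu : dotv mu (fun x => J (phi x)) <= dotv mu (fun x => P.[phi x]) + e * norm1 mu.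
  rewrite -dotv1_norm1// -dotvZr dotvC (dotvC mu (fun x => P.[_])) (dotvC mu) -dotvDl.
  apply: ler_dotv => x; rewrite ler_wpM2r//.
  by have := near x; rewrite ler_norml; lra.
have Pnu : dotv nu (fun x => P.[phi x]) <= dotv nu (fun x => J (phi x)) + e * norm1 nu.
  rewrite -dotv1_norm1// -dotvZr dotvC (dotvC nu (fun x => J _)) (dotvC nu) -dotvDl.
  apply: ler_dotv => x; rewrite ler_wpM2r//.
  by have := near x; rewrite ler_norml; lra.
have : 0 <= norm1 mu by rewrite mulr_ge0 ?invr_ge0 ?ler0n ?sumr_ge0.
have : 0 <= norm1 nu by rewrite mulr_ge0 ?invr_ge0 ?ler0n ?sumr_ge0.
move: P0; rewrite ler_norml => /andP[P0l P0r].
(* [|m - n| + m + n = 2 max(m, n)]: the constant term and the two approximation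
   errors together cost at most [2 e]. *)
have [le|/ltW le] := leP (norm1 mu) (norm1 nu); nra.
Qed.

Theorem theorem4p11 (R : realType) (n : nat) (mu nu : 'I_n -> R) (eta delta : R)
    (N : ('I_n -> R) -> R) (D : ('I_n -> R) -> ('I_n -> R))
    (c : R -> R) (C : nat -> R) :
  (0 < n)%N ->
  (forall x, 0 <= mu x) -> (forall x, 0 <= nu x) ->
  norm1 mu <= 1 -> norm1 nu <= 1 ->
  0 < eta -> 0 < delta -> delta < 1 ->
  QAP_norm N (Xset mu nu) D c C ->
  let J := fun x : R => (x + `|x|) / 2 in
  let eps := delta / (2 * rho' C (C 1%N / c eta) (c eta)^-1 (delta / 4) J) in
  N (fun x => mu x - nu x) <= eps ->
  forall f : 'I_n -> R, (forall x, 0 <= f x <= mu x) ->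
  exists g : 'I_n -> R,
    (forall x, 0 <= g x <= (1 - delta)^-1 * nu x) /\
    N (fun x => f x - g x) <= eta.
Proof.
move=> n0 mu0 nu0 mu1 nu1 eta0 delta0 delta1 qap J eps le_eps f f_mu.
have [normN [normi [c_pos [c_incr [_ [_ [Dc [DC _]]]]]]]] := qap.
have [N0 [Neq0 [NZ _]]] := normN.
suff [g [g_nu Nfg]] : exists g : 'I_n -> R,
    (forall x, 0 <= g x <= nu x) /\ N (fun x => f x - g x) <= eta.
  exists g; split => // x; have /andP[-> gx] := g_nu x; rewrite /=.
  have d1 : 0 < 1 - delta by lra.
  by rewrite ler_pdivlMl//; have := nu0 x; nra.
set S := [set P : {poly R} | forall x, - (C 1%N / c eta) <= x <= C 1%N / c eta ->
            `|P.[x] - J x| <= delta / 4]%classic.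
set V := [set Rprime C P (c eta)^-1 | P in S]%classic.
(* Here [eps <= 0], also when [inf V = 0] since the inverse of 0 is 0. Hence [mu = nu] and [f]
   itself serves as [g]. *)
have [infV0|infV0] := leP (inf V) 0.
  have munu : mu = nu.
    have /Neq0 munu : N (fun x => mu x - nu x) = 0.
      apply/le_anti; rewrite N0 andbT (le_trans le_eps)//.
      rewrite /eps pmulr_rle0// invr_le0 /rho' -/S -/V; lra.
    apply/funext => x; apply/eqP; rewrite -subr_eq0; apply/eqP.
    exact: (congr1 (fun h => h x) munu).
  exists f; split; first by rewrite -munu.
  have -> : (fun x => f x - f x) = (fun x => 0 * 0).
    by apply/funext => x; rewrite subrr mul0r.
  by rewrite NZ normr0 mul0r ltW.
(* Positivity of [inf V] excludes the default value 0, so [V] has a true infimum. The loss of a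
   factor 2 is absorbed by the 2 in [eps]. *)
have [P PS PV] : exists2 P, S P & Rprime C P (c eta)^-1 < 2 * inf V.
  have hasV : has_inf V.
    by apply: contrapT => /inf_out V0; rewrite V0 ltxx in infV0.
  have [_ [P PS <-] PV] := inf_adherent infV0 hasV.
  by exists P => //; rewrite mulr_natl mulr2n.
apply: contrapT => no_g.
have Nfg g : (forall x, 0 <= g x <= nu x) -> eta < N (fun x => f x - g x).
  by move=> g_nu; rewrite ltNge; apply/negP => ?; apply: no_g; exists g.
have Xfg g : (forall x, 0 <= g x <= nu x) -> Xset mu nu (fun x => f x - g x).
  move=> g_nu x; have /andP[g0 gx] := g_nu x; have /andP[f0 fx] := f_mu x.
  by rewrite ler_norml lerNl opprB !le_max; apply/andP; split; apply/orP; 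
     [right|left]; lra.
(* The case of one factor in the product bound, with the sup norm below the dual norm. *)
have Dbound h : Xset mu nu h -> forall x, `|D h x| <= C 1%N.
  move=> hX x; have := DC 1%N (fun=> h) erefl (fun=> hX).
  have := normi (prodD D (fun _ : 'I_1 => h)).
  have := ler_norminf (prodD D (fun _ : 'I_1 => h)) x.
  by rewrite /prodD big_ord1; lra.
have corr g : (forall x, 0 <= g x <= nu x) ->
    c eta <= dotv (fun x => f x - g x) (D (fun x => f x - g x)).
  move=> g_nu; apply: le_trans (ltW (c_incr _ _ eta0 (Nfg g g_nu))) _.
  by apply: Dc; [apply: lt_trans (Nfg g g_nu) | apply: Xfg |].
have ceta := c_pos _ eta0.
(* With this choice [c eta - kappa = c eta * (1 + delta) / 2], which exceeds [c eta * delta] because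
   [delta < 1]; this is the final contradiction. *)
pose kappa := c eta * (1 - delta) / 2.
have kappa0 : 0 < kappa by rewrite divr_gt0// mulr_gt0// subr_gt0.
have [T [gs [T0 gs_nu chiE]]] := oracle_average f nu
  (fun g => D (fun x => f x - g x)) (C 1%N) (c eta) nu0
  (fun g g_nu => Dbound _ (Xfg g g_nu))
  corr _ kappa0.
pose d j := D (fun x => f x - gs j x).
have T0R : 0 < T%:R :> R by rewrite ltr0n.
(* Makes [phi] the average of the [d j] divided by [c eta], so that [a * T] is the point where
   [Rprime] is evaluated in [rho']. *)
pose a := (c eta * T%:R)^-1.
have a0 : 0 < a by rewrite invr_gt0 mulr_gt0.
have aT : a * T%:R = (c eta)^-1 by rewrite /a invfM mulfVK// gt_eqF.
pose phi x := a * \sum_j d j x.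
have phiB x : `|phi x| <= C 1%N / c eta.
  rewrite normrM gtr0_norm// -aT mulrCA ler_pM2l//.
  apply: le_trans (ler_norm_sum _ _ _) _.
  have -> : C 1%N * T%:R = \sum_(j < T) C 1%N by rewrite sumr_const card_ord mulr_natr.
  by apply: ler_sum => j _; apply/Dbound/Xfg/gs_nu.
have C10 : 0 <= C 1%N / c eta by apply: le_trans (phiB (Ordinal n0)).
have J0 : J 0 = 0 by rewrite /J normr0 addr0 mul0r.
have dualC k (t : 'I_k -> 'I_T) : (0 < k)%N ->
    dual_norm N (fun x => \prod_i d (t i) x) <= C k.
  by move=> k0; apply: (DC k (fun i x => f x - gs (t i) x)) => // i; apply: Xfg.
have := transfer_pos_part N mu nu d a (delta / 4) _ C P J normN normi mu0 nu0
  mu1 nu1 (ltW a0) dualC C10 phiB J0 PS.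
rewrite aT -/phi => transfer.
have error : N (fun x => mu x - nu x) * Rprime C P (c eta)^-1 <= delta / 2.
  apply: le_trans (ler_wpM2l (N0 _) (ltW PV)) _.
  apply: le_trans (ler_wpM2r _ le_eps) _; first by rewrite mulr_ge0// ltW.
  rewrite /eps /rho' -/S -/V le_eqVlt; apply/orP; left; apply/eqP.
  by field; rewrite gt_eqF.
(* The maximizer of the pairing with [phi] among functions between 0 and [nu]; the maximum is the
   pairing of [nu] with [J phi]. *)
pose g x := if 0 < phi x then nu x else 0.
have g_nu x : 0 <= g x <= nu x by rewrite /g; case: ifP; rewrite ?lexx nu0.
have := chiE _ g_nu.
have -> : (fun x => T%:R^-1 * \sum_(k < T) d k x) = (fun x => c eta * phi x).
  apply/funext => x; rewrite mulrA; congr (_ * _).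
  by rewrite /a invfM mulrA mulfV ?mul1r// gt_eqF.
rewrite dotvZr dotvBl.
have -> : dotv g phi = dotv nu (fun x => J (phi x)).
  congr (_ * _); apply: eq_bigr => x _; rewrite /g /J.
  have [x0|x0] := ltP 0 (phi x); last by rewrite ler0_norm// subrr !mul0r mulr0.
  by rewrite gtr0_norm//; congr (_ * _); field.
have : dotv f phi <= dotv mu (fun x => J (phi x)).
  apply: ler_dotv => x; have /andP[fx0 fx] := f_mu x; rewrite /J.
  have [x0|x0] := ltP 0 (phi x).
    have -> : (phi x + `|phi x|) / 2 = phi x by rewrite gtr0_norm//; field.
    by rewrite ler_wpM2r// ltW.
  by rewrite ler0_norm// subrr mul0r mulr0 mulr_ge0_le0.
rewrite /kappa; move: (dotv f phi) (dotv mu _) (dotv nu _) transfer error.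
move=> u v w transfer error uv.
have : c eta * (u - w) <= c eta * delta by rewrite ler_pM2l//; lra.
nra.
Qed.
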